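(* Let $n\ge1$, $\delta>0$ and $\beta<n+2$. Let $\mathbf f\in\mathcal H^{s_1}(\mathbf T^n)$ and $\mathbf g\in\mathcal H^{s_2}(\mathbf T^n)$ with $s_1,s_2\in\mathbb{R}$, and for $t\ge0$ define $$\mathbf U(t)=(\widehat{\mathbf f}_0+\widehat{\mathbf g}_0t)+\sum_{0\ne k\in\mathbb{Z}^n}\left(\cos(\sqrt{-M_k}\,t)\widehat{\mathbf f}_k+\sin(\sqrt{-M_k}\,t)(\sqrt{-M_k})^{-1}\widehat{\mathbf g}_k\right)e^{ik\cdot x}.$$ Then for any $t\ge0$, $\mathbf U(t)\in\mathcal H^s(\mathbf T^n)$, where $s=\min\{s_1,s_2+\theta\}$ and $\theta=\max\{0,\frac{\beta-n}{2}\}$.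
   Context: Torus and spaces: $\mathbf T^n=\prod_{i=1}^n[0,2\pi]$ with periodic identification; a periodic vector distribution $\mathbf g$ is written $\mathbf g=\sum_{k\in\mathbb{Z}^n}\widehat{\mathbf g}_k e^{ik\cdot x}$ with Fourier coefficients $\widehat{\mathbf g}_k\in\mathbb{C}^n$. For $q\in\mathbb{R}$, $\mathcal H^q(\mathbf T^n)$ is the space of periodic vector distributions with $\|\mathbf g\|^2_{\mathcal H^q}=\sum_k(1+\|k\|^2)^q\|\widehat{\mathbf g}_k\|^2<\infty$. Multipliers: with ${}_pF_q(a_1,\dots,a_p;b_1,\dots,b_q;x)=\sum_{m\ge0}\frac{(a_1)_m\cdots(a_p)_m}{(b_1)_m\cdots(b_q)_m}\frac{x^m}{m!}$, where $(a)_m=a(a+1)\cdots(a+m-1)$, set for $\nu\in\mathbb{R}^n$ $$\lambda_1(\nu)=-\|\nu\|^2\Big(3\mu\,{}_3F_4\big(1,\tfrac52,\tfrac{n+2-\beta}{2};2,\tfrac32,\tfrac{n+4}{2},\tfrac{n+4-\beta}{2};-\tfrac14\|\nu\|^2\delta^2\big)+(\lambda^*-\mu)\,{}_1F_2\big(\tfrac{n+2-\beta}{2};\tfrac{n+2}{2},\tfrac{n+4-\beta}{2};-\tfrac14\|\nu\|^2\delta^2\big)^2\Big),$$ $$\lambda_2(\nu)=-\mu\|\nu\|^2\,{}_2F_3\big(1,\tfrac{n+2-\beta}{2};2,\tfrac{n+4}{2},\tfrac{n+4-\beta}{2};-\tfrac14\|\nu\|^2\delta^2\big).$$ For $k\in\mathbb{Z}^n\setminus\{0\}$,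 $M_k$ is the real symmetric $n\times n$ matrix with $M_kk=\lambda_1(k)k$ and $M_kw=\lambda_2(k)w$ for $w\perp k$ (the Fourier multiplier of the linear state-based peridynamic operator). $\sqrt{-M_k}$, $\cos(\sqrt{-M_k}t)$, $\sin(\sqrt{-M_k}t)$ are defined by functional calculus: same eigenvectors, with eigenvalues $\sqrt{-\lambda_i(k)}$, $\cos(\sqrt{-\lambda_i(k)}t)$, $\sin(\sqrt{-\lambda_i(k)}t)$. Standing assumption: the Lamé parameters satisfy $\mu>0$ and $\lambda^*\in\mathbb{R}$ is such that $\lambda_1(\nu)<0$ for all $\nu\ne0$ (and $\lambda_2(\nu)<0$ for all $\nu\neq0$). *)

(* Defs.v *)
From mathcomp Require Import all_boot all_order all_algebra.
From mathcomp Require Import complex.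
From mathcomp Require Import all_classical all_reals all_analysis.

Set Implicit Arguments.
Unset Strict Implicit.
Unset Printing Implicit Defensive.

Import Order.TTheory GRing.Theory Num.Theory.
Import numFieldNormedType.Exports.

Local Open Scope classical_set_scope.
Local Open Scope ring_scope.
Local Open Scope complex_scope.

Section Hypergeometric.
Context {R : realType}.

Definition pochhammer (a : R) (m : nat) : R := \prod_(i < m) (a + i%:R).

Definition hyper_term (a b : seq R) (x : R) (m : nat) : R :=
  (\prod_(c <- a) pochhammer c m) / (\prod_(c <- b) pochhammer c m)
  * (x ^+ m / m`!%:R).

(* Meaningful when no [c] in [b] is a nonpositive integer and the series
   converges; it does for every [x] as soon as [size a <= size b]. *)
Definition hyper (a b : seq R) (x : R) : R :=
  limn (series (hyper_term a b x)).

End Hypergeometric.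

Section Vectors.
Context {R : realType} {n : nat}.

Definition dotv (u v : 'cV[R]_n) : R := (u^T *m v) 0 0.

Definition sqnorm (u : 'cV[R]_n) : R := dotv u u.

Definition csqnorm (z : 'cV[R[i]]_n) : R := \sum_i Normc.normc (z i 0) ^+ 2.

Definition freq (k : 'cV[int]_n) : 'cV[R]_n := map_mx intr k.

Definition cmulmx (A : 'M[R]_n) (z : 'cV[R[i]]_n) : 'cV[R[i]]_n :=
  map_mx (real_complex R) A *m z.

End Vectors.

(* A periodic vector distribution is identified with its family of Fourier
   coefficients [g k], i.e. with the formal series [sum_k g_k e^{i k.x}]; the
   families that arise from distributions on the torus are exactly those of at
   most polynomial growth, and the correspondence is one-to-one. *)
Section PeriodicDistributions.
Context {R : realType} {n : nat}.

Definition fourier_family : Type := 'cV[int]_n -> 'cV[R[i]]_n.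

Definition periodic_distribution (g : fourier_family) : Prop :=
  exists (C : R) (N : nat), forall k : 'cV[int]_n,
    csqnorm (g k) <= C * (1 + sqnorm (freq k)) ^+ N.

Definition sobolev_sqnorm (q : R) (g : fourier_family) : \bar R :=
  \esum_(k in [set: 'cV[int]_n])
    ((1 + sqnorm (freq k)) `^ q * csqnorm (g k))%:E.

Definition sobolev (q : R) : set fourier_family :=
  [set g | periodic_distribution g /\ (sobolev_sqnorm q g < +oo)%E].

End PeriodicDistributions.
Arguments fourier_family : clear implicits.

Section AxisMatrices.
Context {R : realType} {n : nat}.

Definition axis_proj (u : 'cV[R]_n) : 'M[R]_n := (sqnorm u)^-1 *: (u *m u^T).

Definition axis_mx (u : 'cV[R]_n) (a b : R) : 'M[R]_n :=
  a *: axis_proj u + b *: (1%:M - axis_proj u).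

Lemma sqnorm_eq0 (u : 'cV[R]_n) : (sqnorm u == 0) = (u == 0).
Proof.
apply/eqP/eqP => [|->]; last by rewrite /sqnorm /dotv mulmx0 mxE.
rewrite /sqnorm /dotv mxE => /eqP.
rewrite psumr_eq0 => [/allP u0|i _]; last by rewrite mxE -expr2 sqr_ge0.
apply/matrixP => i j; rewrite ord1 [RHS]mxE.
by have := u0 i (mem_index_enum i); rewrite /= mxE -expr2 sqrf_eq0 => /eqP.
Qed.

Lemma axis_projE (u w : 'cV[R]_n) :
  axis_proj u *m w = (dotv u w / sqnorm u) *: u.
Proof.
rewrite -scalemxAl -mulmxA [u^T *m w]mx11_scalar -/(dotv u w).
by rewrite mul_mx_scalar scalerA mulrC.
Qed.

(* The lemmas [axis_mx_axis], [axis_mx_orth], [tr_axis_mx] and [axis_mx_uniq]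
   say that [axis_mx u a b] is the only matrix acting as [a] on [u] and as [b]
   on the orthogonal complement of [u], and that it is symmetric. *)
Lemma axis_mx_axis (u : 'cV[R]_n) (a b : R) :
  u != 0 -> axis_mx u a b *m u = a *: u.
Proof.
move=> u0; rewrite mulmxDl -(scalemxAl a) -(scalemxAl b) mulmxBl mul1mx.
rewrite axis_projE.
by rewrite -/(sqnorm u) divff ?sqnorm_eq0// scale1r subrr scaler0 addr0.
Qed.

Lemma axis_mx_orth (u w : 'cV[R]_n) (a b : R) :
  dotv u w = 0 -> axis_mx u a b *m w = b *: w.
Proof.
move=> uw0; rewrite mulmxDl -(scalemxAl a) -(scalemxAl b) mulmxBl mul1mx.
rewrite axis_projE.
by rewrite uw0 mul0r scale0r scaler0 add0r subr0.
Qed.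

Lemma tr_axis_mx (u : 'cV[R]_n) (a b : R) : (axis_mx u a b)^T = axis_mx u a b.
Proof.
have tr_proj : (axis_proj u)^T = axis_proj u.
  by rewrite /axis_proj linearZ/= trmx_mul trmxK.
move: tr_proj; rewrite /axis_mx; move: (axis_proj u) => P trP.
by rewrite linearD/= !linearZ/= linearB/= trP trmx1.
Qed.

Lemma axis_decomp (u w : 'cV[R]_n) : u != 0 ->
  dotv u (w - (dotv u w / sqnorm u) *: u) = 0.
Proof.
move=> u0; rewrite /dotv mulmxBr -scalemxAr mxE [X in _ + X]mxE [X in _ - X]mxE.
by rewrite -/(dotv u w) -/(dotv u u) -/(sqnorm u) divfK ?subrr ?sqnorm_eq0.
Qed.

Lemma axis_mx_uniq (u : 'cV[R]_n) (a b : R) (A : 'M[R]_n) : u != 0 ->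
  A *m u = a *: u -> (forall w, dotv u w = 0 -> A *m w = b *: w) ->
  A = axis_mx u a b.
Proof.
move=> u0 Au Aw.
have E (w : 'cV[R]_n) : A *m w = axis_mx u a b *m w.
  have w'0 := axis_decomp w u0; set c := dotv u w / sqnorm u in w'0.
  rewrite -(subrK (c *: u) w); move: (w - c *: u) w'0 => w' w'0.
  by rewrite !mulmxDr -!scalemxAr Au axis_mx_axis// Aw// axis_mx_orth.
apply/matrixP => i j; have := E (delta_mx j 0); rewrite -!colE.
by move/colP => /(_ i); rewrite !mxE.
Qed.

End AxisMatrices.

Section Peridynamics.
Context {R : realType} (n : nat) (delta beta mu lam : R).

Definition lambda1 (nu : 'cV[R]_n) : R :=
  - sqnorm nu *
    (3 * mu *
       hyper [:: 1; 5 / 2; (n%:R + 2 - beta) / 2]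
             [:: 2; 3 / 2; (n%:R + 4) / 2; (n%:R + 4 - beta) / 2]
             (- (1 / 4) * sqnorm nu * delta ^+ 2)
     + (lam - mu) *
       hyper [:: (n%:R + 2 - beta) / 2]
             [:: (n%:R + 2) / 2; (n%:R + 4 - beta) / 2]
             (- (1 / 4) * sqnorm nu * delta ^+ 2) ^+ 2).

Definition lambda2 (nu : 'cV[R]_n) : R :=
  - mu * sqnorm nu *
    hyper [:: 1; (n%:R + 2 - beta) / 2]
          [:: 2; (n%:R + 4) / 2; (n%:R + 4 - beta) / 2]
          (- (1 / 4) * sqnorm nu * delta ^+ 2).

Definition multiplier (k : 'cV[int]_n) : 'M[R]_n :=
  axis_mx (freq k) (lambda1 (freq k)) (lambda2 (freq k)).

(* [h (multiplier k)] in the sense of the functional calculus; see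
   [fun_multiplierP]. *)
Definition fun_multiplier (h : R -> R) (k : 'cV[int]_n) : 'M[R]_n :=
  axis_mx (freq k) (h (lambda1 (freq k))) (h (lambda2 (freq k))).

Lemma fun_multiplierP (h : R -> R) (k : 'cV[int]_n) (a : R) (v : 'cV[R]_n) :
  k != 0 -> multiplier k *m v = a *: v -> fun_multiplier h k *m v = h a *: v.
Proof.
move=> k0; have u0 : freq k != 0 :> 'cV[R]_n.
  apply: contra k0 => /eqP/matrixP k0; apply/eqP/matrixP => i j.
  by have := k0 i j; rewrite !mxE => /eqP; rewrite intr_eq0 => /eqP.
rewrite /multiplier /fun_multiplier; set u := freq k.
set l1 := lambda1 u; set l2 := lambda2 u; set c := dotv u v / sqnorm u.
have w0 := axis_decomp v u0; rewrite -(subrK (c *: u) v); move: (v - c *: u) w0 => w w0.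
rewrite [w + _]addrC !mulmxDr -!scalemxAr !axis_mx_axis// !axis_mx_orth// => E.
have {}E : (c * (l1 - a)) *: u = (a - l2) *: w.
  apply/eqP; rewrite mulrBr !scalerBl subr_eq addrAC eq_sym subr_eq.
  by rewrite -[(c * l1) *: u]scalerA E scalerDr scalerA [c * a]mulrC addrC.
have cl : c * (l1 - a) = 0.
  have : dotv u ((c * (l1 - a)) *: u) = 0.
    by rewrite E /dotv -scalemxAr mxE -/(dotv u w) w0 mulr0.
  rewrite /dotv -scalemxAr mxE -/(dotv u u) -/(sqnorm u) => /eqP.
  by rewrite mulf_eq0 sqnorm_eq0 (negPf u0) orbF => /eqP.
move: E; rewrite cl scale0r => /esym/eqP; rewrite scaler_eq0 => lw.
rewrite scalerDr; congr (_ + _).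
  move/eqP: cl; rewrite mulf_eq0 subr_eq0 => /orP[/eqP->|/eqP->].
    by rewrite !scale0r scaler0.
  by rewrite !scalerA mulrC.
by case/orP: lw => [|/eqP->]; rewrite ?scaler0// subr_eq0 => /eqP->.
Qed.

Definition sqrt_multiplier (k : 'cV[int]_n) : 'M[R]_n :=
  fun_multiplier (fun x => Num.sqrt (- x)) k.

Definition cos_multiplier (t : R) (k : 'cV[int]_n) : 'M[R]_n :=
  fun_multiplier (fun x => cos (Num.sqrt (- x) * t)) k.

Definition sin_multiplier (t : R) (k : 'cV[int]_n) : 'M[R]_n :=
  fun_multiplier (fun x => sin (Num.sqrt (- x) * t)) k.

Definition peridynamic_solution (f g : fourier_family R n) (t : R) :
    fourier_family R n :=
  fun k =>
    if k == 0 then f 0 + t%:C *: g 0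
    else cmulmx (cos_multiplier t k) (f k)
         + cmulmx (sin_multiplier t k *m invmx (sqrt_multiplier k)) (g k).

End Peridynamics.

(* Main.v *)
Require Import Defs.
From mathcomp Require Import all_boot all_order all_algebra.
From mathcomp Require Import complex.
From mathcomp Require Import all_classical all_reals all_analysis.
From mathcomp Require Import ring lra.

Import Order.TTheory GRing.Theory Num.Theory.
Import numFieldNormedType.Exports.

Local Open Scope classical_set_scope.
Local Open Scope ring_scope.

(** The operators act mode by mode. The cosine factor has norm at most 1, so the
    whole question is how fast sin(r t)/r decays, where r = sqrt(-lambda_i(k)).
    It is at most t and at most 1/r. The bound t settles the case beta <= n, in
    which no derivative is gained. For n < beta < n + 2 a gain of
    theta = (beta - n)/2 derivatives amounts to -lambda_i(nu) >= k |nu|^(2 theta)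
    for large nu ([lambda_coercive]); bounded frequencies are again controlled
    by t ([wave_sin_decay]).

    Put x = |nu|^2 delta^2 / 4, a = (n + 2 - beta)/2 and c = n/2 + 1. Then
    0 < a < 1 and theta = 1 - a, so coercivity says that x^a times the
    hypergeometric factor of lambda_i stays away from 0 as x grows. All the
    hypergeometric functions involved have the form
      F(x) = a * int_0^1 r^(a-1) S(r x) dr
    for an explicit entire function S, hence (x^a F(x))' = a x^(a-1) S(x)
    ([is_derive_mean]). With Phi(x) = 0F1(; c; -x), which is a Bessel function
    in disguise, S is
      - c (1 - Phi(x)) / x for the 2F3 of lambda_2,
      - c (1 - Phi(x) - 2 x Phi'(x)) / x for three times the 3F4 of lambda_1,
      - Phi(x) for the 1F2 that lambda_1 contains squared.

    The first two are nonnegative because Phi <= 1 and Phi + 2 x Phi' <= 1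
    ([bessel_le1], [bessel_radial_le1]); both bounds come from quantities that
    decrease along the differential equation x Phi'' + c Phi' + Phi = 0. Hence
    x^a F is nondecreasing, and it is positive near 0, which bounds it from
    below ([mean_lower]). The coefficient of the squared 1F2 may be negative,
    so that term has to be of lower order: |Phi(x)| <= C x^(-1/2)
    ([bessel_decay]) implies that the square is O(x^(-a (2 - a))), and
    a (2 - a) > a ([dilatation_upper]). *)

(** * Entire functions given by their coefficients *)
Section FactorialSeries.
Context {R : realType}.
Implicit Types (h : nat -> R) (x : R).

(** Coefficients of an entire function of exponential type. Allowing powers of
    [r], and not just a multiple of [1 / m`!], makes the class stable under
    multiplication by [m]; the exponent [m.+1] lets the single constant [r] also
    absorb a constant factor. *)
Definition exp_type h :=
  exists2 r : R, 1 <= r & forall m, `|h m| * m`!%:R <= r ^+ m.+1.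

Definition psum h x : R := limn (pseries h x).

Lemma is_cvg_psum h x : exp_type h -> cvgn (pseries h x).
Proof.
move=> [r r1 hr]; have r0 : 0 <= r by rewrite (le_trans _ r1).
apply: normed_cvg.
apply: (@series_le_cvg _ _ (fun m => r * exp_coeff (r * `|x|) m)) => [m|m|m|] //=.
- by rewrite mulr_ge0// exp_coeff_ge0// mulr_ge0.
- rewrite normrM normrX /exp_coeff /= exprMn mulrA mulrA -exprS mulrAC.
  by rewrite ler_wpM2r ?exprn_ge0// ler_pdivlMr ?ltr0n ?fact_gt0.
exact: (is_cvg_seriesZ (is_cvg_series_exp_coeff _)).
Qed.

Lemma exp_type_le h1 h2 :
  (forall m, `|h1 m| <= `|h2 m|) -> exp_type h2 -> exp_type h1.
Proof.
move=> h12 [r r1 hr]; exists r => // m; apply: le_trans (hr m).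
by rewrite ler_wpM2r.
Qed.

Lemma exp_typeZ (c : R) h : exp_type h -> exp_type (fun m => c * h m).
Proof.
move=> [r r1 hr]; have c1 : 1 <= 1 + `|c| by rewrite lerDl.
exists ((1 + `|c|) * r) => [|m]; first by rewrite mulr_ege1.
rewrite normrM -mulrA exprMn ler_pM// ?mulr_ge0//.
by rewrite (le_trans _ (ler_eXnr _ c1))// lerDr.
Qed.

Lemma exp_typeD h1 h2 :
  exp_type h1 -> exp_type h2 -> exp_type (fun m => h1 m + h2 m).
Proof.
move=> [r r1 hr] [s s1 hs]; exists (r + s) => [|m].
  by rewrite (le_trans r1)// lerDl (le_trans _ s1).
have r0 : 0 <= r by rewrite (le_trans _ r1).
have s0 : 0 <= s by rewrite (le_trans _ s1).
rewrite (le_trans (ler_wpM2r _ (ler_normD _ _)))// [leLHS]mulrDl.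
rewrite (le_trans (lerD (hr m) (hs m)))// !exprS mulrDl.
by apply: lerD; rewrite ler_wpM2l// lerXn2r ?nnegrE ?addr_ge0 ?lerDl ?lerDr.
Qed.

Lemma exp_type_shift h : exp_type h -> exp_type (fun m => h m.+1).
Proof.
move=> [r r1 hr]; exists (r ^+ 2) => [|m]; first by rewrite exprn_ege1.
rewrite -exprM mul2n (le_trans (_ : _ <= `|h m.+1| * m.+1`!%:R))//.
  by rewrite ler_wpM2l// ler_nat factS leq_pmull.
by rewrite (le_trans (hr m.+1))// ler_weXn2l// -addnn addnS !ltnS leq_addr.
Qed.

Lemma exp_type_euler h : exp_type h -> exp_type (fun m => m%:R * h m).
Proof.
move=> [r r1 hr]; exists (2 * r) => [|m].
  by rewrite mulr_ege1// ler1n.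
rewrite normrM ger0_norm// -mulrA exprMn; apply: ler_pM; rewrite ?mulr_ge0//.
rewrite -natrX ler_nat.
by rewrite (leq_trans (ltnW (ltn_expl m (ltnSn 1))))// leq_exp2l.
Qed.

Lemma exp_type_diffs h : exp_type h -> exp_type (pseries_diffs h).
Proof. by move=> hh; apply: (exp_type_shift _ (exp_type_euler _ hh)). Qed.

Lemma psumZ (c : R) h x :
  exp_type h -> psum (fun m => c * h m) x = c * psum h x.
Proof.
move=> hh; rewrite /psum -[RHS](lim_seriesZ c (is_cvg_psum _ x hh)).
by congr (limn (series _)); apply/funext => i /=; rewrite -mulrA.
Qed.

Lemma psumD h1 h2 x : exp_type h1 -> exp_type h2 ->
  psum (fun m => h1 m + h2 m) x = psum h1 x + psum h2 x.
Proof.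
move=> hh1 hh2; rewrite /psum.
rewrite -(lim_seriesD (is_cvg_psum _ x hh1) (is_cvg_psum _ x hh2)).
congr (limn (series _)); apply/funext => i /=; exact: mulrDl.
Qed.

Lemma psum_recl h x : exp_type h ->
  psum h x = h 0 + x * psum (fun m => h m.+1) x.
Proof.
move=> hh; have cv' := is_cvg_psum _ x (exp_type_shift _ hh).
have sE m : pseries h x m.+1 = h 0 + x * pseries (fun m => h m.+1) x m.
  rewrite /pseries /series /= big_nat_recl//= expr0 mulr1 mulr_sumr.
  by congr (_ + _); apply: eq_bigr => i _; rewrite exprS mulrCA.
rewrite /psum; have /cvg_lim <- // : pseries h x @ \oo -->
    h 0 + x * limn (pseries (fun m => h m.+1) x).
rewrite -cvg_shiftS (_ : [sequence _]_n =
  fun m => h 0 + x * pseries (fun m => h m.+1) x m); last exact/funext.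
apply: cvgD; first exact: cvg_cst.
exact: (cvgMl_tmp cv').
Qed.

Lemma is_derive_psum h x : exp_type h ->
  is_derive x 1 (psum h) (psum (pseries_diffs h) x).
Proof.
move=> hh; apply: (@pseries_snd_diffs _ _ (`|x| + 1)).
- exact: is_cvg_psum.
- exact/is_cvg_psum/exp_type_diffs.
- exact/is_cvg_psum/exp_type_diffs/exp_type_diffs.
- by rewrite [ltRHS]ger0_norm ?addr_ge0// ltrDl.
Qed.

(** The Euler operator [x d/dx] multiplies the [m]-th coefficient by [m]. All the
    differential equations below are checked on coefficients through this. *)
Lemma psum_euler h x : exp_type h ->
  x * psum (pseries_diffs h) x = psum (fun m => m%:R * h m) x.
Proof.
by move=> hh; rewrite [RHS]psum_recl ?mul0r ?add0r//; apply: exp_type_euler.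
Qed.

Lemma psum0 h : exp_type h -> psum h 0 = h 0.
Proof. by move=> hh; rewrite psum_recl// mul0r addr0. Qed.

End FactorialSeries.

(** * Monotonicity *)
Section Calculus.
Context {R : realType}.
Implicit Types (f g : R -> R) (x : R).

Lemma ndecr_of_derive f (df : R -> R) a :
  (forall x, a <= x -> is_derive x 1 f (df x)) ->
  (forall x, a <= x -> 0 <= df x) ->
  forall x, a <= x -> f a <= f x.
Proof.
move=> fd d0 x ax; rewrite -subr_ge0.
have [|z|z|c + ->] := @MVT_segment _ f df a x.
- by [].
- by rewrite in_itv /= => /andP[/ltW az _]; exact: fd.
- apply: derivable_within_continuous => y; rewrite in_itv /= => /andP[ay _].
  by have [] := fd _ ay.
by rewrite in_itv /= => /andP[ac _]; rewrite mulr_ge0 ?subr_ge0// d0.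
Qed.

End Calculus.

(** * Pochhammer symbols *)
Section Pochhammer.
Context {R : realType}.
Implicit Types (c : R) (m : nat).

Lemma pochhammer0 c : pochhammer c 0 = 1.
Proof. by rewrite /pochhammer big_ord0. Qed.

Lemma pochhammerSr c m : pochhammer c m.+1 = pochhammer c m * (c + m%:R).
Proof. by rewrite /pochhammer big_ord_recr. Qed.

Lemma pochhammerSl c m : pochhammer c m.+1 = c * pochhammer (c + 1) m.
Proof.
rewrite /pochhammer big_ord_recl addr0; congr (_ * _).
by apply: eq_bigr => i _; rewrite lift0 -natr1 addrA addrAC.
Qed.

Lemma pochhammer_gt0 c m : 0 < c -> 0 < pochhammer c m.
Proof. by move=> c0; apply: prodr_gt0 => i _; rewrite ltr_pwDl. Qed.

Lemma pochhammer_ratio c m : 0 < c ->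
  pochhammer c m / pochhammer (c + 1) m = c / (c + m%:R).
Proof.
move=> c0; have p0 := pochhammer_gt0 (c + 1) m (addr_gt0 c0 ltr01).
have q0 : 0 < c + m%:R by rewrite ltr_pwDl.
by apply/eqP; rewrite eqr_div ?lt0r_neq0// -pochhammerSl pochhammerSr.
Qed.

Lemma pochhammer1 m : pochhammer 1 m = m`!%:R :> R.
Proof.
elim: m => [|m IH]; first by rewrite pochhammer0.
by rewrite pochhammerSr IH factS mulnC natrM -natr1 [1 + _]addrC.
Qed.

Lemma pochhammer2 m : pochhammer 2 m = m.+1`!%:R :> R.
Proof. by rewrite -pochhammer1 pochhammerSl mul1r. Qed.

Lemma pochhammer_ge_half c m : 1 / 2 <= c -> 1 / 2 <= pochhammer c m.
Proof.
move=> c0; case: m => [|m]; first by rewrite pochhammer0; lra.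
elim: m => [|m IH]; first by rewrite pochhammerSr pochhammer0; lra.
rewrite pochhammerSr (le_trans IH)// ler_peMr//; first by lra.
by rewrite -natr1; have := ler0n R m; lra.
Qed.

End Pochhammer.

(** * The functions 0F1(; c; -x) *)
Section Bessel.
Context {R : realType}.
Implicit Types (c x : R) (m : nat).

(** [bessel c x] is [0F1(; c; -x)], that is, up to the constant [Gamma(c)],
    [x^(-(c-1)/2) J_(c-1)(2 sqrt x)]. *)
Definition bessel_coef c m : R := (-1) ^+ m / (m`!%:R * pochhammer c m).

Definition bessel c : R -> R := psum (bessel_coef c).

Definition dbessel c : R -> R := psum (pseries_diffs (bessel_coef c)).

Definition ddbessel c : R -> R :=
  psum (pseries_diffs (pseries_diffs (bessel_coef c))).

Lemma exp_type_bessel c : 1 / 2 <= c -> exp_type (bessel_coef c).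
Proof.
move=> c0; exists 2 => [|m]; first by rewrite ler1n.
have pm := pochhammer_ge_half c m c0.
have p0 : 0 < pochhammer c m by lra.
rewrite /bessel_coef normrM normrX normrN1 expr1n mul1r normfV.
have f0 : 0 < m`!%:R :> R by rewrite ltr0n fact_gt0.
rewrite ger0_norm; last by rewrite mulr_ge0 ?ltW.
rewrite invfM mulrAC mulVf ?lt0r_neq0// mul1r.
rewrite (@le_trans _ _ 2)//; last by rewrite ler_eXnr// ler1n.
by rewrite -[leRHS]invrK lef_pV2 ?posrE ?invr_gt0//; lra.
Qed.

Lemma bessel_coefS c m : 0 < c ->
  m.+1%:R * (c + m%:R) * bessel_coef c m.+1 = - bessel_coef c m.
Proof.
move=> c0; rewrite /bessel_coef pochhammerSr factS natrM exprS.
have := pochhammer_gt0 c m c0; move: (pochhammer c m) => p p0.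
have : 0 < c + m%:R by rewrite ltr_pwDl.
move: (c + _) => q q0; have := fact_gt0 m; rewrite -(ltr0n R).
move: (m`!%:R) => r r0; have : 0 < m.+1%:R :> R by rewrite ltr0n.
by move: (m.+1%:R) => s s0; field; rewrite !gt_eqF.
Qed.

(** Raising the parameter is differentiation: this transfers a bound on the
    derivative to a decay estimate for the next parameter. *)
Lemma dbesselE c x : 1 / 2 <= c -> c * dbessel c x = - bessel (c + 1) x.
Proof.
move=> c0; have c0' : 0 < c by lra.
rewrite /dbessel -psumZ; last exact/exp_type_diffs/exp_type_bessel.
rewrite -mulN1r /bessel -psumZ; last by apply: exp_type_bessel; lra.
congr psum; apply/funext => m; rewrite /pseries_diffs /bessel_coef.
rewrite pochhammerSl factS natrM exprS.
have := pochhammer_gt0 (c + 1) m (addr_gt0 c0' ltr01).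
move: (pochhammer _ m) => p p0.
have := fact_gt0 m; rewrite -(ltr0n R).
move: (m`!%:R) => r r0; have : 0 < m.+1%:R :> R by rewrite ltr0n.
by move: (m.+1%:R) => s s0; field; rewrite !gt_eqF.
Qed.

Lemma bessel_ode c x : 1 / 2 <= c ->
  x * ddbessel c x + c * dbessel c x + bessel c x = 0.
Proof.
move=> c0; have eb := exp_type_bessel c c0; have ed := exp_type_diffs _ eb.
rewrite /ddbessel psum_euler// -psumZ// -psumD; last 2 first.
- exact: exp_type_euler.
- exact: exp_typeZ.
rewrite -psumD//; last first.
  by apply: exp_typeD; [exact: exp_type_euler|exact: exp_typeZ].
rewrite -[RHS](mul0r (bessel c x)) -psumZ//; congr psum; apply/funext => m.
rewrite mul0r -mulrDl [_ + c]addrC mulrA [_ * m.+1%:R]mulrC bessel_coefS ?addNr//.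
by lra.
Qed.

Lemma is_derive_bessel c x : 1 / 2 <= c ->
  is_derive x 1 (bessel c) (dbessel c x).
Proof. by move=> c0; apply/is_derive_psum/exp_type_bessel. Qed.

Lemma is_derive_dbessel c x : 1 / 2 <= c ->
  is_derive x 1 (dbessel c) (ddbessel c x).
Proof. by move=> c0; apply/is_derive_psum/exp_type_diffs/exp_type_bessel. Qed.

Lemma bessel0 c : 1 / 2 <= c -> bessel c 0 = 1.
Proof.
move=> c0; rewrite /bessel psum0; last exact: exp_type_bessel.
by rewrite /bessel_coef pochhammer0 fact0 expr0 mulr1 divr1.
Qed.

(** The left-hand side equals 1 at 0, and along the differential equation its
    derivative is [- (2 c - 1) Phi'^2 <= 0]. *)
Lemma bessel_energy c x : 1 / 2 <= c -> 0 <= x ->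
  bessel c x ^+ 2 + x * dbessel c x ^+ 2 <= 1.
Proof.
move=> c0 x0; pose p := bessel c; pose q := dbessel c.
pose E y := - (p y * p y + y * (q y * q y)).
suff : E 0 <= E x by rewrite /E /p /q bessel0// mul0r !expr2; lra.
apply: (@ndecr_of_derive _ E (fun y => (2 * c - 1) * q y ^+ 2) 0) => // y y0.
- have dp := is_derive_bessel c y c0; have dq := is_derive_dbessel c y c0.
  apply: is_derive_eq; rewrite /GRing.scale /= -/(p y) -/(q y).
  have := bessel_ode c y c0; rewrite -/(p y) -/(q y).
  set r := ddbessel c y => ode.
  have -> : p y = - (y * r + c * q y) by lra.
  by ring.
- by rewrite mulr_ge0 ?sqr_ge0//; lra.
Qed.

(** The energy of [bessel c] bounds [x * dbessel c x ^+ 2], and [dbessel c] is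
    [bessel (c + 1)] up to the factor [- c]. *)
Lemma bessel_decay c x : 1 / 2 <= c -> 0 <= x ->
  x * bessel (c + 1) x ^+ 2 <= c ^+ 2.
Proof.
move=> c0 x0; rewrite -sqrrN -dbesselE// exprMn mulrCA ler_piMr ?sqr_ge0//.
by rewrite (le_trans _ (bessel_energy c x c0 x0))// lerDr sqr_ge0.
Qed.

Lemma bessel_le1 c x : 1 / 2 <= c -> 0 <= x -> bessel c x <= 1.
Proof.
move=> c0 x0; rewrite (le_trans (ler_norm _))//.
rewrite -(@expr_le1 _ 2)// real_normK ?num_real//.
have := bessel_energy c x c0 x0; have : 0 <= x * dbessel c x ^+ 2.
  by rewrite mulr_ge0 ?sqr_ge0.
lra.
Qed.

(** Put [P = Phi + 2 x Phi'] and [N = 2 c - 3 >= 0]. In the variable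
    [z = 2 sqrt x] one has [P = d(z Phi)/dz], which is [cos z] when [c = 3/2],
    and the sum [P^2 + (dP/dz)^2] is then constant. For general [c] the right
    quantity is [P^2 + x (2 Phi + N Phi')^2 + 2 N x Phi'^2]: the last term is the
    multiple of [x Phi'^2] that turns the derivative into minus a square, namely
    [- N (2 Phi + (N + 2) Phi')^2]. *)
Lemma bessel_radial_le1 c x : 3 / 2 <= c -> 0 <= x ->
  bessel c x + 2 * (x * dbessel c x) <= 1.
Proof.
move=> c0 x0; have c1 : 1 / 2 <= c by lra.
pose p := bessel c; pose q := dbessel c; pose N := 2 * c - 3.
have N0 : 0 <= N by rewrite /N; lra.
pose P y := p y + 2 * (y * q y); pose Q y := 2 * p y + N * q y.
(* Opposite sign, because the monotonicity criterion is for nondecreasing functions. *)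
pose E y := - (P y * P y + y * (Q y * Q y + 2 * N * (q y * q y))).
have e : E 0 <= E x.
  apply: (@ndecr_of_derive _ E
      (fun y => N * (2 * p y + (N + 2) * q y) ^+ 2) 0) => // y y0.
  - have dp := is_derive_bessel c y c1; have dq := is_derive_dbessel c y c1.
    apply: is_derive_eq.
    rewrite /P /Q /GRing.scale /= -/(p y) -/(q y).
    have := bessel_ode c y c1; rewrite -/(p y) -/(q y).
    set r := ddbessel c y => ode.
    have -> : p y = - (y * r + c * q y) by lra.
    rewrite /N; ring.
  - by rewrite mulr_ge0 ?sqr_ge0.
rewrite -/(p x) -/(q x) -/(P x) (le_trans (ler_norm _))//.
rewrite -(@expr_le1 _ 2)// real_normK ?num_real//.
have : 0 <= x * (Q x * Q x + 2 * N * (q x * q x)).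
  by rewrite -!expr2 mulr_ge0// addr_ge0 ?sqr_ge0// mulr_ge0 ?sqr_ge0// mulr_ge0.
have P0 : P 0 = 1 by rewrite /P /p bessel0// mul0r mulr0 addr0.
by move: e; rewrite /E P0 mul0r expr2; lra.
Qed.

End Bessel.

(** * Radial means of entire functions *)
Section RadialMean.
Context {R : realType}.
Implicit Types (h : nat -> R) (a x y : R).

(** The coefficients of [x |-> a * int_0^1 r^(a-1) S(r x) dr], when those of [S]
    are [h]; the factor is [a int_0^1 r^(a+m-1) dr]. *)
Definition mean_coef a h m : R := a / (a + m%:R) * h m.

Lemma exp_type_mean a h : 0 < a -> exp_type h -> exp_type (mean_coef a h).
Proof.
move=> a0; apply: exp_type_le => m; have am : 0 < a + m%:R by rewrite ltr_pwDl.
rewrite /mean_coef normrM ler_piMl// ger0_norm; last by rewrite divr_ge0 ?ltW.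
by rewrite ler_pdivrMr// mul1r lerDl.
Qed.

Lemma mean_euler a h x : 0 < a -> exp_type h ->
  a * psum (mean_coef a h) x + x * psum (pseries_diffs (mean_coef a h)) x =
  a * psum h x.
Proof.
move=> a0 eh; have em := exp_type_mean a h a0 eh.
rewrite psum_euler// -!psumZ// -psumD; last 2 first.
- exact: exp_typeZ.
- exact: exp_type_euler.
congr psum; apply/funext => m; rewrite -mulrDl /mean_coef mulrA mulrCA.
by rewrite divff ?mulr1// lt0r_neq0// ltr_pwDl.
Qed.

Lemma is_derive_mean a h x : 0 < a -> exp_type h -> 0 < x ->
  is_derive x 1 (fun y => y `^ a * psum (mean_coef a h) y)
    (a * x `^ (a - 1) * psum h x).
Proof.
move=> a0 eh x0; have dm := is_derive_psum _ x (exp_type_mean a h a0 eh).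
have dp := is_derive1_powR a x0.
apply: is_derive_eq; rewrite /GRing.scale /=.
have -> : x `^ a = x `^ (a - 1) * x.
  rewrite -[X in _ = _ * X](powRr1 (ltW x0)) -powRD ?subrK//.
  by rewrite (gt_eqF x0) implybT.
rewrite [RHS]mulrAC -(mean_euler a h)//; ring.
Qed.

(** [x^a] times the mean has derivative [a x^(a-1) S(x) >= 0], and the mean is
    close to [h 0 > 0] for small [x]. *)
Lemma mean_lower a h : 0 < a -> exp_type h -> 0 < h 0 ->
  (forall x, 0 < x -> 0 <= psum h x) ->
  exists2 k, 0 < k & exists2 X, 0 < X &
    forall x, X <= x -> k <= x `^ a * psum (mean_coef a h) x.
Proof.
move=> a0 eh h0 hge0; have em := exp_type_mean a h a0 eh.
have [X X0 FX] : exists2 X, 0 < X & 0 < psum (mean_coef a h) X.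
  have cF : {for 0, continuous (psum (mean_coef a h))}.
    apply/differentiable_continuous/derivable1_diffP.
    by have [] := is_derive_psum _ 0 em.
  have F0 : 0 < psum (mean_coef a h) 0.
    by rewrite psum0// /mean_coef addr0 divff ?mul1r// lt0r_neq0.
  have /nbhs_ballP[e /= e0 eF] : nbhs (0 : R) [set y | 0 < psum (mean_coef a h) y].
    exact: (cvgr_gt _ cF _ F0).
  exists (e / 2); first by rewrite divr_gt0.
  apply: eF; rewrite /ball /= sub0r normrN gtr0_norm ?divr_gt0//.
  by rewrite ltr_pdivrMr// ltr_pMr// ltr1n.
exists (X `^ a * psum (mean_coef a h) X); first by rewrite mulr_gt0// powR_gt0.
exists X => // x Xx.
apply: (@ndecr_of_derive _ (fun y => y `^ a * psum (mean_coef a h) y)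
  (fun x => a * x `^ (a - 1) * psum h x) X) => // y Xy.
- by apply: is_derive_mean => //; exact: lt_le_trans Xy.
- have y0 := lt_le_trans X0 Xy.
  by rewrite mulr_ge0 ?hge0// mulr_ge0 ?powR_ge0// ltW.
Qed.

(** For [M = a K / (a - b)] the derivative of [M x^(a-b)] dominates that of
    [x^a] times the mean [F] in absolute value, so both [M x^(a-b) +/- x^a F(x)]
    are nondecreasing on [1, +oo). Requiring [b < a] keeps the contribution of
    bounded [x], which is [O(1) / x^a], below [x^(-b)]. *)
Lemma mean_upper a (b K : R) h : 0 < b -> b < a -> exp_type h ->
  (forall x, 1 <= x -> x `^ b * `|psum h x| <= K) ->
  exists2 C, 0 <= C & forall x, 1 <= x ->
    x `^ b * `|psum (mean_coef a h) x| <= C.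
Proof.
move=> b0 ba eh hK; have a0 : 0 < a by rewrite (lt_trans b0).
have ab0 : 0 < a - b by rewrite subr_gt0.
have K0 : 0 <= K by rewrite (le_trans _ (hK 1 (lexx _)))// mulr_ge0 ?powR_ge0.
pose F := psum (mean_coef a h); pose M := a * K / (a - b).
have M0 : 0 <= M by rewrite divr_ge0// ?mulr_ge0// ltW.
have bound (s : R) : `|s| = 1 -> forall x, 1 <= x ->
    - (s * (x `^ a * F x)) <= (M + `|F 1|) * x `^ (a - b).
  move=> s1 x x1.
  have : M * 1 `^ (a - b) + s * (1 `^ a * F 1) <=
         M * x `^ (a - b) + s * (x `^ a * F x).
    apply: (@ndecr_of_derive _ (fun y => M * y `^ (a - b) + s * (y `^ a * F y))
      (fun y => a * y `^ (a - 1) / y `^ b * (K + s * (y `^ b * psum h y)))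
      1) => // y y1.
    - have y0 : 0 < y by rewrite (lt_le_trans ltr01).
      have dp := is_derive1_powR (a - b) y0.
      have dm := is_derive_mean a h y a0 eh y0.
      apply: is_derive_eq; rewrite /GRing.scale /= ?mulr0 ?addr0 ?add0r.
      have yb : y `^ b != 0 by rewrite lt0r_neq0// powR_gt0.
      rewrite (_ : a - b - 1 = (a - 1) - b); last by ring.
      rewrite [y `^ (a - 1 - b)]powRB; last by rewrite (gt_eqF y0) implybT.
      by rewrite /M; field; rewrite yb lt0r_neq0.
    - have y0 : 0 < y by rewrite (lt_le_trans ltr01).
      apply: mulr_ge0.
        by rewrite divr_ge0 ?mulr_ge0 ?powR_ge0//; exact: ltW.
      rewrite -[s * _]opprK subr_ge0 (le_trans (ler_norm _))//.
      by rewrite normrN !normrM s1 mul1r ger0_norm ?powR_ge0// hK.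
  rewrite !powR1 mulr1 mul1r => e.
  have : - (s * F 1) <= `|F 1|.
    by rewrite (le_trans (ler_norm _))// normrN normrM s1 mul1r.
  have : 1 <= x `^ (a - b) by rewrite -[leLHS](powRr0 x) ler_powR// ltW.
  move: (x `^ (a - b)) e => w e w1 F1.
  have : `|F 1| <= `|F 1| * w by rewrite ler_peMr.
  rewrite mulrDl; lra.
exists (M + `|F 1|) => [|x x1]; first by rewrite addr_ge0.
have x0 : 0 < x by rewrite (lt_le_trans ltr01).
have h1 := bound 1 (normr1 _) x x1.
have h2 := bound (-1) (etrans (normrN _) (normr1 _)) x x1.
have w0 : 0 < x `^ (a - b) by rewrite powR_gt0.
rewrite -(ler_pM2r w0) mulrAC -powRD ?(gt_eqF x0) ?implybT//.
rewrite [b + _]addrC subrK -[x `^ a]ger0_norm ?powR_ge0// -normrM ler_norml.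
rewrite -/F; move: h1 h2; rewrite mulN1r mul1r opprK => h1 h2.
by apply/andP; split; lra.
Qed.

End RadialMean.

(** * Asymptotics of the hypergeometric factors *)
Section HypergeometricMultipliers.
Context {R : realType}.
Implicit Types (a c x : R) (m : nat).

(** Coefficients of [c (1 - Phi(x)) / x], where [Phi = bessel c]. *)
Definition transverse_coef c m : R := - c * bessel_coef c m.+1.

(** Coefficients of [c (1 - Phi(x) - 2 x Phi'(x)) / x]: the factor [2 m + 3]
    stems from [(5/2)_m / (3/2)_m = (2 m + 3) / 3]. *)
Definition radial_coef c m : R := (2 * m%:R + 3) * transverse_coef c m.

Lemma transverse_coefE c m : 0 < c ->
  transverse_coef c m = (-1) ^+ m / (m.+1`!%:R * pochhammer (c + 1) m).
Proof.
move=> c0; rewrite /transverse_coef /bessel_coef pochhammerSl exprS.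
have := pochhammer_gt0 (c + 1) m (addr_gt0 c0 ltr01).
move: (pochhammer _ m) => p p0.
have := fact_gt0 m.+1; rewrite -(ltr0n R); move: (m.+1`!%:R) => f f0.
by field; rewrite !lt0r_neq0.
Qed.

Lemma exp_type_transverse c : 1 / 2 <= c -> exp_type (transverse_coef c).
Proof. by move=> c0; apply/exp_typeZ/exp_type_shift/exp_type_bessel. Qed.

Lemma exp_type_radial c : 1 / 2 <= c -> exp_type (radial_coef c).
Proof.
move=> c0; have et := exp_type_transverse c c0.
rewrite (_ : radial_coef c = fun m =>
    2 * (m%:R * transverse_coef c m) + 3 * transverse_coef c m).
  by apply: exp_typeD; apply: exp_typeZ => //; exact: exp_type_euler.
by apply/funext => m; rewrite /radial_coef mulrDl mulrA.
Qed.

Lemma psum_transverse c x : 1 / 2 <= c ->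
  x * psum (transverse_coef c) x = c * (1 - bessel c x).
Proof.
move=> c0; have eb := exp_type_bessel c c0.
rewrite psumZ; last exact: exp_type_shift.
rewrite -(bessel0 c c0) /bessel psum0// [in RHS](psum_recl _ x)//; ring.
Qed.

Lemma psum_radial c x : 1 / 2 <= c ->
  x * psum (radial_coef c) x = c * (1 - (bessel c x + 2 * (x * dbessel c x))).
Proof.
move=> c0; have eb := exp_type_bessel c c0; have ee := exp_type_euler _ eb.
pose h m := - c * (2 * (m%:R * bessel_coef c m) + bessel_coef c m).
have eh : exp_type h by apply/exp_typeZ/exp_typeD => //; exact: exp_typeZ.
have -> : radial_coef c = fun m => h m.+1.
  apply/funext => m; rewrite /h /radial_coef /transverse_coef -natr1; ring.
have := psum_recl h x eh; rewrite /dbessel psum_euler// /h psumZ; last first.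
  by apply/exp_typeD => //; exact: exp_typeZ.
rewrite psumD//; last exact: exp_typeZ.
rewrite psumZ// -/(bessel c x) mul0r mulr0 add0r.
have := bessel0 c c0; rewrite /bessel psum0// => ->; rewrite /= => e; lra.
Qed.

Lemma hyperN (a b : seq R) x :
  hyper a b (- x) = psum (fun m => (-1) ^+ m / m`!%:R *
    (\prod_(c <- a) pochhammer c m / \prod_(c <- b) pochhammer c m)) x.
Proof.
rewrite /hyper /psum; congr (limn (series _)); apply/funext => m /=.
rewrite /hyper_term (exprNn x) [LHS]mulrC -!mulrA; congr (_ * _).
by rewrite mulrC !mulrA.
Qed.

Lemma hyper_dilatation a c x : 0 < a -> 0 < c ->
  hyper [:: a] [:: c; a + 1] (- x) = psum (mean_coef a (bessel_coef c)) x.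
Proof.
move=> a0 c0; rewrite hyperN; congr psum; apply/funext => m.
rewrite !big_cons !big_nil !mulr1 /mean_coef -pochhammer_ratio// /bessel_coef.
rewrite !invfM; ring.
Qed.

Lemma hyper_transverse a c x : 0 < a -> 0 < c ->
  hyper [:: 1; a] [:: 2; c + 1; a + 1] (- x) =
  psum (mean_coef a (transverse_coef c)) x.
Proof.
move=> a0 c0; rewrite hyperN; congr psum; apply/funext => m.
rewrite !big_cons !big_nil !mulr1 /mean_coef -pochhammer_ratio//.
rewrite transverse_coefE// pochhammer1 pochhammer2 !invfM.
have := fact_gt0 m; rewrite -(ltr0n R) => /lt0r_neq0 f0.
by rewrite -[X in _ = _ * X](mulKf f0); ring.
Qed.

Lemma hyper_radial a c x : 0 < a -> 1 / 2 <= c ->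
  3 * hyper [:: 1; 5 / 2; a] [:: 2; 3 / 2; c + 1; a + 1] (- x) =
  psum (mean_coef a (radial_coef c)) x.
Proof.
move=> a0 c0; have c0' : 0 < c by lra.
have er := exp_type_mean a _ a0 (exp_type_radial c c0).
have E : mean_coef a (radial_coef c) = fun m => 3 * ((-1) ^+ m / m`!%:R *
    (\prod_(d <- [:: 1; 5 / 2; a]) pochhammer d m /
     \prod_(d <- [:: 2; 3 / 2; c + 1; a + 1]) pochhammer d m)).
  apply/funext => m.
  rewrite !big_cons !big_nil !mulr1 /mean_coef -pochhammer_ratio//.
  rewrite /radial_coef transverse_coefE// pochhammer1 pochhammer2.
  have h0 : 0 < 3 / 2 :> R by lra.
  have -> : pochhammer (5 / 2) m = (2 * m%:R + 3) / 3 * pochhammer (3 / 2) m :> R.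
    apply: (mulfI (lt0r_neq0 h0)).
    rewrite (_ : 5 / 2 = 3 / 2 + 1 :> R); last by lra.
    by rewrite -pochhammerSl pochhammerSr; field.
  have := pochhammer_gt0 _ m h0; move: (pochhammer (3 / 2) m) => p p0.
  have := pochhammer_gt0 _ m (addr_gt0 c0' ltr01).
  move: (pochhammer (c + 1) m) => q q0.
  have := pochhammer_gt0 _ m (addr_gt0 a0 ltr01).
  move: (pochhammer (a + 1) m) => s s0.
  have := fact_gt0 m; rewrite -(ltr0n R); move: (m`!%:R) => r r0.
  have := fact_gt0 m.+1; rewrite -(ltr0n R); move: (m.+1`!%:R) => u u0.
  by field; rewrite !lt0r_neq0.
rewrite hyperN E psumZ//; set h := (X in exp_type X) in E *.
have -> : h = fun m => 3^-1 * (mean_coef a (radial_coef c) m).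
  by rewrite E; apply/funext => m; rewrite mulKf// lt0r_neq0.
exact: exp_typeZ.
Qed.

Lemma transverse_lower a c : 0 < a -> 1 / 2 <= c ->
  exists2 k, 0 < k & exists2 X, 0 < X & forall x, X <= x ->
    k <= x `^ a * hyper [:: 1; a] [:: 2; c + 1; a + 1] (- x).
Proof.
move=> a0 c0; have c0' : 0 < c by lra.
have h0 : 0 < transverse_coef c 0.
  by rewrite transverse_coefE// pochhammer0 mulr1 divr1.
have hx x : 0 < x -> 0 <= psum (transverse_coef c) x.
  move=> x0; rewrite -(pmulr_rge0 _ x0) psum_transverse//.
  apply: mulr_ge0; first exact: ltW.
  by rewrite subr_ge0 bessel_le1// ltW.
have [k k0 [X X0 kX]] := mean_lower a _ a0 (exp_type_transverse c c0) h0 hx.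
by exists k => //; exists X => // x /kX; rewrite hyper_transverse.
Qed.

Lemma radial_lower a c : 0 < a -> 3 / 2 <= c ->
  exists2 k, 0 < k & exists2 X, 0 < X & forall x, X <= x ->
    k <= x `^ a *
         (3 * hyper [:: 1; 5 / 2; a] [:: 2; 3 / 2; c + 1; a + 1] (- x)).
Proof.
move=> a0 c1; have c0 : 1 / 2 <= c by lra.
have c0' : 0 < c by lra.
have h0 : 0 < radial_coef c 0.
  rewrite /radial_coef transverse_coefE// pochhammer0 mulr1 divr1.
  by rewrite mulr0 add0r mulr1.
have hx x : 0 < x -> 0 <= psum (radial_coef c) x.
  move=> x0; rewrite -(pmulr_rge0 _ x0) psum_radial//.
  apply: mulr_ge0; first exact: ltW.
  by rewrite subr_ge0 bessel_radial_le1// ltW.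
have [k k0 [X X0 kX]] := mean_lower a _ a0 (exp_type_radial c c0) h0 hx.
by exists k => //; exists X => // x /kX; rewrite hyper_radial.
Qed.

(** Without any cancellation [Phi] is [O(x^(-1/2))], hence [O(x^(-b))] for every
    [b <= 1/2]. The exponent [b = a (2 - a) / 2] satisfies [a / 2 < b] as well as
    [b < a] and [b <= 1/2] for all [a] in (0, 1): the mean then inherits the rate
    [x^(-b)], and its square is [o(x^(-a))]. *)
Lemma dilatation_upper a c : 0 < a -> a < 1 -> 3 / 2 <= c ->
  exists2 C, 0 <= C & forall x, 1 <= x ->
    x `^ (a * (2 - a)) * hyper [:: a] [:: c; a + 1] (- x) ^+ 2 <= C.
Proof.
move=> a0 a1 c1; have c0 : 1 / 2 <= c by lra.
have c0' : 0 < c by lra.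
pose b := a * (2 - a) / 2.
have b0 : 0 < b by rewrite divr_gt0// mulr_gt0// subr_gt0; lra.
have ba : b < a by rewrite /b; nra.
have bh : b + b <= 1 by rewrite /b; nra.
have sq x y : 0 < x -> (x `^ b * `|y|) ^+ 2 = x `^ (b + b) * y ^+ 2.
  move=> x0; rewrite exprMn real_normK ?num_real// expr2 -powRD//.
  by rewrite (gt_eqF x0) implybT.
have hK x : 1 <= x -> x `^ b * `|psum (bessel_coef c) x| <= c - 1.
  move=> x1; have x0 : 0 < x by rewrite (lt_le_trans ltr01).
  rewrite -(@ler_pXn2r _ 2) ?nnegrE ?mulr_ge0 ?powR_ge0//; last by lra.
  rewrite sq// (le_trans (_ : _ <= x * bessel c x ^+ 2))//.
    by rewrite ler_wpM2r ?sqr_ge0// -[leRHS](powRr1 (ltW x0)) ler_powR.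
  have := bessel_decay (c - 1) x; rewrite subrK; apply; last exact: ltW.
  by lra.
have [C C0 hC] := mean_upper a b (c - 1) _ b0 ba (exp_type_bessel c c0) hK.
exists (C ^+ 2) => [|x x1]; first exact: sqr_ge0.
have x0 : 0 < x by rewrite (lt_le_trans ltr01).
rewrite (_ : a * (2 - a) = b + b); last by rewrite /b; field.
rewrite hyper_dilatation// -sq// ler_pXn2r ?nnegrE ?mulr_ge0 ?powR_ge0//.
exact: hC.
Qed.

(** The term in [l] is [O(x^(-p))] with [p = a (1 - a) > 0] after multiplication
    by [x^a], so that half of the lower bound of the first term survives for
    large [x], whatever the sign of [l]. *)
Lemma longitudinal_lower a c (mu l : R) :
  0 < a -> a < 1 -> 3 / 2 <= c -> 0 < mu ->
  exists2 k, 0 < k & exists2 X, 0 < X & forall x, X <= x ->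
    k <= x `^ a *
      (3 * mu * hyper [:: 1; 5 / 2; a] [:: 2; 3 / 2; c + 1; a + 1] (- x)
       + l * hyper [:: a] [:: c; a + 1] (- x) ^+ 2).
Proof.
move=> a0 a1 c1 mu0; have [k k0 [X X0 kX]] := radial_lower a c a0 c1.
have [C C0 hC] := dilatation_upper a c a0 a1 c1.
pose p := a * (1 - a); have p0 : 0 < p by rewrite mulr_gt0// subr_gt0.
pose A := 1 + 2 * `|l| * C / (mu * k).
have mk0 : 0 < mu * k by rewrite mulr_gt0.
have A1 : 1 <= A by rewrite lerDl divr_ge0 ?mulr_ge0// ltW.
exists (mu * k / 2); first by rewrite divr_gt0.
(* The threshold for x `^ p >= A; it also exceeds 1, as A does. *)
exists (X + A `^ p^-1) => [|x Xx]; first by rewrite ltr_pwDl// powR_ge0.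
have Ap1 : 1 <= A `^ p^-1.
  suff : 1 `^ p^-1 <= A `^ p^-1 by rewrite powR1.
  by apply: ge0_ler_powR; rewrite ?nnegrE ?invr_ge0 ?(ltW p0)//; lra.
have x1 : 1 <= x by lra.
have x0 : 0 < x by lra.
have {}kX : k <= _ := kX x ltac:(lra).
have Axp : A <= x `^ p.
  rewrite -[leLHS]powRr1; last by lra.
  rewrite -(mulVf (lt0r_neq0 p0)) powRrM ge0_ler_powR ?nnegrE//; lra.
have {}hC := hC x x1; move: kX hC.
set F := hyper _ _ _; set Q := hyper _ _ _.
rewrite (_ : a * (2 - a) = a + p); last by rewrite /p; ring.
rewrite powRD; last by rewrite (gt_eqF x0) implybT.
move: (x `^ a) (powR_ge0 x a) => w w0 kF hC.
have wQ : 0 <= w * Q ^+ 2 by rewrite mulr_ge0 ?sqr_ge0.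
have hA : `|l| * (w * Q ^+ 2) <= mu * k / 2.
  have AQ : A * (w * Q ^+ 2) <= C.
    by apply: le_trans hC; rewrite mulrAC [leRHS]mulrC ler_wpM2r.
  have A2 : 2 * `|l| * C <= A * (mu * k).
    have -> : A * (mu * k) = mu * k + 2 * `|l| * C.
      by rewrite /A; field; rewrite !lt0r_neq0.
    by rewrite lerDr ltW.
  have A0 : 0 < A by lra.
  rewrite -(ler_pM2l A0) mulrCA (le_trans (ler_wpM2l (normr_ge0 l) AQ))//.
  by rewrite mulrA ler_pdivlMr//; lra.
have lQ : - (l * (w * Q ^+ 2)) <= `|l| * (w * Q ^+ 2).
  by rewrite -[in leRHS](ger0_norm wQ) -normrM -normrN ler_norm.
have mF : mu * k <= mu * (w * (3 * F)) by rewrite ler_pM2l.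
lra.
Qed.

End HypergeometricMultipliers.

(** * Norms of axis matrices *)
Section AxisBounds.
Context {R : realType} {n : nat}.
Implicit Types (u v w : 'cV[R]_n) (z : 'cV[R[i]]_n) (a b x y M : R).

Lemma dotvE u v : dotv u v = \sum_i u i 0 * v i 0.
Proof. by rewrite /dotv mxE; apply: eq_bigr => i _; rewrite mxE. Qed.

Lemma sqnorm_ge0 u : 0 <= sqnorm u.
Proof. by rewrite /sqnorm dotvE sumr_ge0// => i _; rewrite -expr2 sqr_ge0. Qed.

Lemma sqnorm_pythagoras u w x y : dotv u w = 0 ->
  sqnorm (x *: u + y *: w) = x ^+ 2 * sqnorm u + y ^+ 2 * sqnorm w.
Proof.
move=> uw0.
transitivity (x ^+ 2 * sqnorm u + 2 * x * y * dotv u w + y ^+ 2 * sqnorm w).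
  rewrite /sqnorm !dotvE !mulr_sumr -!big_split/=.
  by apply: eq_bigr => i _; rewrite !mxE; ring.
by rewrite uw0 mulr0 addr0.
Qed.

(** The axis and its orthogonal complement are invariant and orthogonal, so
    Pythagoras applies before and after. *)
Lemma sqnorm_axis_le u w a b M : u != 0 -> a ^+ 2 <= M -> b ^+ 2 <= M ->
  sqnorm (axis_mx u a b *m w) <= M * sqnorm w.
Proof.
move=> u0 aM bM; have w0 := axis_decomp w u0.
rewrite -(subrK ((dotv u w / sqnorm u) *: u) w) addrC.
move: (dotv u w / sqnorm u) (w - _) w0 => x v uv0.
rewrite mulmxDr -scalemxAr axis_mx_axis// axis_mx_orth// scalerA.
rewrite sqnorm_pythagoras// -[X in x *: u + X]scale1r sqnorm_pythagoras//.
rewrite mulrDr; apply: lerD.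
  by rewrite exprMn mulrA [M * _]mulrC !ler_wpM2r ?sqnorm_ge0// ler_wpM2l ?sqr_ge0.
by rewrite expr1n mul1r ler_wpM2r ?sqnorm_ge0.
Qed.

Lemma axis_mxM u a b a' b' : u != 0 ->
  axis_mx u a b *m axis_mx u a' b' = axis_mx u (a * a') (b * b').
Proof.
move=> u0; apply: axis_mx_uniq => // [|w uw0]; rewrite -mulmxA.
  by rewrite axis_mx_axis// -scalemxAr axis_mx_axis// scalerA mulrC.
by rewrite (axis_mx_orth _ _ uw0) -scalemxAr (axis_mx_orth _ _ uw0) scalerA mulrC.
Qed.

Lemma invmx_axis u a b : u != 0 -> a != 0 -> b != 0 ->
  invmx (axis_mx u a b) = axis_mx u a^-1 b^-1.
Proof.
move=> u0 a0 b0; have E : axis_mx u a b *m axis_mx u a^-1 b^-1 = 1%:M.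
  by rewrite axis_mxM// !divff// /axis_mx !scale1r addrC subrK.
by have [uA _] := mulmx1_unit E; rewrite -[LHS]mulmx1 -E mulKmx.
Qed.

Lemma csqnormE z : csqnorm z =
  sqnorm (map_mx (@complex.Re R) z) + sqnorm (map_mx (@complex.Im R) z).
Proof.
rewrite /sqnorm !dotvE -big_split; apply: eq_bigr => i _ /=; rewrite !mxE.
case: (z i 0) => x y /=.
by rewrite sqr_sqrtr ?addr_ge0 ?sqr_ge0// !expr2.
Qed.

Lemma csqnorm_ge0 z : 0 <= csqnorm z.
Proof. by rewrite csqnormE addr_ge0 ?sqnorm_ge0. Qed.

Lemma csqnormD z1 z2 : csqnorm (z1 + z2) <= 2 * csqnorm z1 + 2 * csqnorm z2.
Proof.
rewrite /csqnorm !mulr_sumr -big_split; apply: ler_sum => i _ /=.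
rewrite mxE; case: (z1 i 0) (z2 i 0) => [a b] [c d] /=.
rewrite !sqr_sqrtr ?addr_ge0 ?sqr_ge0//.
by have := sqr_ge0 (a - c); have := sqr_ge0 (b - d); lra.
Qed.

Lemma csqnormZ a z : csqnorm (a%:C%C *: z) = a ^+ 2 * csqnorm z.
Proof.
rewrite /csqnorm mulr_sumr; apply: eq_bigr => i _; rewrite mxE.
case: (z i 0) => x y /=; rewrite !sqr_sqrtr ?addr_ge0 ?sqr_ge0//; ring.
Qed.

(** The matrix is real, so it acts separately on real and imaginary parts. *)
Lemma csqnorm_axis_le u z a b M : u != 0 -> a ^+ 2 <= M -> b ^+ 2 <= M ->
  csqnorm (cmulmx (axis_mx u a b) z) <= M * csqnorm z.
Proof.
move=> u0 aM bM; rewrite !csqnormE mulrDr /cmulmx.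
have Re_mul (A : 'M[R]_n) :
    map_mx (@complex.Re R) (map_mx (real_complex R) A *m z) =
    A *m map_mx (@complex.Re R) z.
  apply/matrixP => i j; rewrite !mxE.
  elim/big_rec2: _ => //= k x y _ <-; rewrite !mxE.
  by case: (z k j) y => [c d] [e f] /=; rewrite mul0r subr0.
have Im_mul (A : 'M[R]_n) :
    map_mx (@complex.Im R) (map_mx (real_complex R) A *m z) =
    A *m map_mx (@complex.Im R) z.
  apply/matrixP => i j; rewrite !mxE.
  elim/big_rec2: _ => //= k x y _ <-; rewrite !mxE.
  by case: (z k j) y => [c d] [e f] /=; rewrite mul0r addr0.
by rewrite Re_mul Im_mul lerD// sqnorm_axis_le.
Qed.

End AxisBounds.

(** * Domination of unordered sums *)
Section SumDomination.
Context {R : realType} {T : choiceType}.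
Local Open Scope ereal_scope.

Lemma esum_lty_le (C : R) (u f g : T -> R) : (0 <= C)%R ->
  (forall k, 0 <= f k)%R -> (forall k, 0 <= g k)%R ->
  (forall k, u k <= C * (f k + g k))%R ->
  \esum_(k in [set: T]) (f k)%:E < +oo ->
  \esum_(k in [set: T]) (g k)%:E < +oo ->
  \esum_(k in [set: T]) (u k)%:E < +oo.
Proof.
move=> C0 f0 g0 ufg fy gy.
pose h k := (f k)%:E + (g k)%:E.
have h0 k : 0 <= h k by rewrite adde_ge0 ?lee_fin.
have hy : \esum_(k in [set: T]) h k < +oo.
  by rewrite esumD ?lte_add_pinfty// => k _; rewrite lee_fin.
apply: (@le_lt_trans _ _ (C%:E * \esum_(k in [set: T]) h k)); last first.
  by rewrite lte_mul_pinfty.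
apply: ge_ereal_sup => _ [X [finX XT] <-].
apply: (@le_trans _ _ (\sum_(k \in X) (C%:E * h k))).
  by apply: lee_fsum => // k _; rewrite lee_fin.
rewrite -ge0_mule_fsumr// lee_wpmul2l ?lee_fin//.
by apply: ereal_sup_ubound; exists X.
Qed.

End SumDomination.

(** * The scalar sine multiplier *)
Section WaveMultipliers.
Context {R : realType}.
Implicit Types (t s theta c L Y : R).

Definition wave_sin t L : R :=
  sin (Num.sqrt (- L) * t) * (Num.sqrt (- L))^-1.

Lemma sin_sqr_le x : 0 <= x -> sin x ^+ 2 <= x ^+ 2 :> R.
Proof.
move=> x0.
have h1 : 0 - sin 0 <= x - sin x.
  apply: (@ndecr_of_derive _ (fun y => y - sin y) (fun y => 1 - cos y)) x0 => y _.
  by rewrite subr_ge0 cos_le1.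
have h2 : 0 + sin 0 <= x + sin x.
  apply: (@ndecr_of_derive _ (fun y => y + sin y) (fun y => 1 + cos y)) x0 => y _.
  by rewrite -lerBlDl sub0r cos_geN1.
move: h1 h2; rewrite /= sin0 => h1 h2.
rewrite -[leLHS]real_normK ?num_real// ler_pXn2r ?nnegrE// ler_norml.
by apply/andP; split; lra.
Qed.

Lemma wave_sin_le_time t L : 0 <= t -> L < 0 -> wave_sin t L ^+ 2 <= t ^+ 2.
Proof.
move=> t0 L0; have r0 : 0 < Num.sqrt (- L) by rewrite sqrtr_gt0 oppr_gt0.
rewrite /wave_sin; move: (Num.sqrt _) r0 => r r0.
rewrite exprMn exprVn ler_pdivrMr ?exprn_gt0// mulrC -exprMn.
by rewrite sin_sqr_le// mulr_ge0// ltW.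
Qed.

Lemma wave_sin_le_inv t L : L < 0 -> wave_sin t L ^+ 2 <= (- L)^-1.
Proof.
move=> L0; have L0' : 0 < - L by rewrite oppr_gt0.
rewrite /wave_sin exprMn exprVn sqr_sqrtr ?(ltW L0')//.
by rewrite ler_piMl ?invr_ge0 ?(ltW L0')// sin2cos2 gerBl sqr_ge0.
Qed.

(** For [s <= 1 + Y] the weight is bounded and the bound by time is enough; beyond
    that the coercivity estimate applies, and [1 + s <= 2 s]. *)
Lemma wave_sin_decay t theta c Y : 0 <= t -> 0 <= theta -> 0 < c -> 0 < Y ->
  exists2 C, 0 <= C & forall s L, 0 <= s -> L < 0 ->
    (Y <= s -> c * s `^ theta <= - L) ->
    wave_sin t L ^+ 2 * (1 + s) `^ theta <= C.
Proof.
move=> t0 th0 c0 Y0.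
exists (t ^+ 2 * (2 + Y) `^ theta + 2 `^ theta / c) => [|s L s0 L0 sL].
  by rewrite addr_ge0 ?mulr_ge0 ?sqr_ge0 ?powR_ge0 ?invr_ge0 ?(ltW c0).
have [sY|sY] := leP s (1 + Y).
  rewrite (@le_trans _ _ (t ^+ 2 * (2 + Y) `^ theta))//; last first.
    by rewrite lerDl divr_ge0 ?powR_ge0 ?ltW.
  rewrite ler_pM ?sqr_ge0 ?powR_ge0 ?wave_sin_le_time//.
  by rewrite ge0_ler_powR ?nnegrE//; lra.
rewrite (@le_trans _ _ (2 `^ theta / c))//; last first.
  by rewrite lerDr mulr_ge0 ?sqr_ge0 ?powR_ge0.
have s1 : 0 < s `^ theta by rewrite powR_gt0//; lra.
have {}sL : c * s `^ theta <= - L by apply: sL; lra.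
rewrite (@le_trans _ _ ((c * s `^ theta)^-1 * (2 * s) `^ theta))//.
  rewrite ler_pM ?sqr_ge0 ?powR_ge0//; last first.
    by rewrite ge0_ler_powR ?nnegrE//; lra.
  rewrite (le_trans (wave_sin_le_inv t L L0))// lef_pV2 ?posrE ?mulr_gt0//.
  by rewrite oppr_gt0.
rewrite powRM//.
by rewrite invfM mulrACA mulVf ?lt0r_neq0// mulr1 mulrC.
Qed.

(** Passes from the variable [x = D s] of the hypergeometric functions to
    [s = |nu|^2], and from decay like [x^(-a)] of the factor [H] to growth like
    [s^(1-a)] of the symbol [s H]. *)
Lemma coercive_rescale (a D X k H : R) s : 0 < D -> 0 < s -> 
  (X <= D * s -> k <= (D * s) `^ a * H) -> X / D <= s ->
  k / D `^ a * s `^ (1 - a) <= s * H.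
Proof.
move=> D0 s0 kH sX.
have {}kH : k <= (D * s) `^ a * H by apply: kH; rewrite mulrC -ler_pdivrMr.
have Da : 0 < D `^ a by rewrite powR_gt0.
have sa : 0 < s `^ a by rewrite powR_gt0.
have E : s `^ (1 - a) * s `^ a = s.
  rewrite -powRD; last by rewrite (gt_eqF s0) implybT.
  by rewrite subrK powRr1// ltW.
rewrite -(ler_pM2r sa) -[leLHS]mulrA E mulrC -[leRHS]mulrA ler_pM2l//.
rewrite ler_pdivrMr// (le_trans kH)// powRM ?(ltW D0) ?(ltW s0)//.
by rewrite le_eqVlt; apply/orP; left; apply/eqP; ring.
Qed.

End WaveMultipliers.

(** * Regularity of the peridynamic wave equation *)
Lemma freq_neq0 (R : realType) (n : nat) (k : 'cV[int]_n) :
  k != 0 -> freq k != 0 :> 'cV[R]_n.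
Proof.
apply: contra => /eqP/matrixP k0; apply/eqP/matrixP => i j.
by have := k0 i j; rewrite !mxE => /eqP; rewrite intr_eq0 => /eqP.
Qed.

Section PeridynamicRegularity.
Context {R : realType} (n : nat) (delta beta mu lam : R).
Context (n_ge1 : (1 <= n)%N) (delta_gt0 : 0 < delta).
Context (beta_lt : beta < n%:R + 2) (mu_gt0 : 0 < mu).
Context (lambda1_lt0 : forall nu : 'cV[R]_n,
  nu != 0 -> lambda1 delta beta mu lam nu < 0).
Context (lambda2_lt0 : forall nu : 'cV[R]_n,
  nu != 0 -> lambda2 delta beta mu nu < 0).
Implicit Types (nu : 'cV[R]_n) (t : R) (f g : fourier_family R n).

Let a : R := (n%:R + 2 - beta) / 2.
Let c : R := (n%:R + 2) / 2.
Let D : R := delta ^+ 2 / 4.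

(** Since [(beta - n)/2 = 1 - a], this combines [longitudinal_lower] for
    [lambda1] and [transverse_lower] for [lambda2]. *)
Lemma lambda_coercive : n%:R < beta ->
  exists2 k, 0 < k & exists2 Y, 0 < Y & forall nu, nu != 0 ->
    Y <= sqnorm nu ->
    k * sqnorm nu `^ ((beta - n%:R) / 2) <= - lambda1 delta beta mu lam nu /\
    k * sqnorm nu `^ ((beta - n%:R) / 2) <= - lambda2 delta beta mu nu.
Proof.
move=> nbeta.
have n1 : 1 <= n%:R :> R by rewrite ler1n.
have a0 : 0 < a by rewrite /a divr_gt0// subr_gt0.
have a1 : a < 1 by rewrite /a ltr_pdivrMr// mul1r; lra.
have c1 : 3 / 2 <= c by rewrite /c ler_pM2r ?invr_gt0//; lra.
have c0 : 1 / 2 <= c by lra.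
have D0 : 0 < D by rewrite /D divr_gt0// exprn_gt0.
have Da : 0 < D `^ a by rewrite powR_gt0.
have [k1 k10 [X1 X10 kX1]] := longitudinal_lower a c mu (lam - mu) a0 a1 c1 mu_gt0.
have [k2 k20 [X2 X20 kX2]] := transverse_lower a c a0 c0.
have thE : (beta - n%:R) / 2 = 1 - a by rewrite /a; field.
pose k := Num.min k1 (mu * k2).
have k0 : 0 < k by rewrite lt_min k10 mulr_gt0.
exists (k / D `^ a); first by rewrite divr_gt0.
exists ((X1 + X2) / D) => [|nu nu0 nuY]; first by rewrite divr_gt0 ?addr_gt0.
have s0 : 0 < sqnorm nu by rewrite lt_neqAle eq_sym sqnorm_eq0 nu0 sqnorm_ge0.
have argE : - (1 / 4) * sqnorm nu * delta ^+ 2 = - (D * sqnorm nu).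
  by rewrite /D; field.
have bE : (n%:R + 4) / 2 = c + 1 by rewrite /c; field.
have aE : (n%:R + 4 - beta) / 2 = a + 1 by rewrite /a; field.
rewrite /lambda1 /lambda2 argE bE aE -/a -/c thE; split.
- rewrite mulNr opprK; apply: coercive_rescale nuY => // h.
  rewrite (@le_trans _ _ k1) ?ge_min ?lexx//.
  by apply: kX1; lra.
- rewrite !mulNr opprK [mu * sqnorm _]mulrC -[leRHS]mulrA.
  apply: coercive_rescale nuY => // h.
  rewrite (@le_trans _ _ (mu * k2)) ?ge_min ?lexx ?orbT//.
  by rewrite mulrCA ler_pM2l//; apply: kX2; lra.
Qed.

Let theta : R := Num.max 0 ((beta - n%:R) / 2).

(** For [beta <= n] the exponent is 0 and the bound by time is the claim; otherwise
    coercivity provides the gain of [theta] derivatives. *)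
Lemma wave_sin_multiplier_bound t : 0 <= t ->
  exists2 C, 0 <= C & forall nu, nu != 0 ->
    wave_sin t (lambda1 delta beta mu lam nu) ^+ 2
      <= C * (1 + sqnorm nu) `^ (- theta) /\
    wave_sin t (lambda2 delta beta mu nu) ^+ 2
      <= C * (1 + sqnorm nu) `^ (- theta).
Proof.
move=> t0; have [nbeta|betan] := ltP n%:R beta; last first.
  have th0 : theta = 0.
    by rewrite /theta; apply/max_idPl; rewrite pmulr_lle0 ?invr_gt0// subr_le0.
  exists (t ^+ 2) => [|nu nu0]; first exact: sqr_ge0.
  by rewrite th0 oppr0 powRr0 mulr1 !wave_sin_le_time ?lambda1_lt0 ?lambda2_lt0.
have th0 : 0 < (beta - n%:R) / 2 by rewrite divr_gt0// subr_gt0.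
have thE : theta = (beta - n%:R) / 2 by apply/max_idPr; exact: ltW.
have [k k0 [Y Y0 kY]] := lambda_coercive nbeta.
have [C C0 hC] := wave_sin_decay t _ k Y t0 (ltW th0) k0 Y0.
exists C => // nu nu0; have s0 := sqnorm_ge0 nu.
have w0 : 0 < 1 + sqnorm nu by lra.
have w1 : 0 < (1 + sqnorm nu) `^ theta by rewrite powR_gt0.
rewrite powRN !ler_pdivlMr// thE; split; apply: hC => //.
- exact: lambda1_lt0.
- by move=> /(kY nu nu0)[].
- exact: lambda2_lt0.
- by move=> /(kY nu nu0)[].
Qed.

Lemma peridynamic_solution_bound f g t : 0 <= t ->
  exists2 C, 0 <= C & forall k,
    csqnorm (peridynamic_solution delta beta mu lam f g t k) <=
    C * (csqnorm (f k) +
         (1 + sqnorm (freq k)) `^ (- theta) * csqnorm (g k)).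
Proof.
move=> t0; have [C C0 hC] := wave_sin_multiplier_bound t t0.
exists (2 + 2 * t ^+ 2 + 2 * C) => [|k].
  by have := sqr_ge0 t; lra.
have f0 := csqnorm_ge0 (f k); have g0 := csqnorm_ge0 (g k).
have t2 := sqr_ge0 t.
rewrite /peridynamic_solution; case: eqVneq => [k0|k0].
  have -> : sqnorm (freq k : 'cV[R]_n) = 0.
    by apply/eqP; rewrite sqnorm_eq0 k0; apply/eqP/matrixP => i j; rewrite !mxE.
  rewrite addr0 powR1 mul1r (le_trans (csqnormD _ _))// csqnormZ -k0.
  have := mulr_ge0 t2 f0; have := mulr_ge0 t2 g0.
  have := mulr_ge0 C0 f0; have := mulr_ge0 C0 g0; lra.
have u0 := freq_neq0 R _ k k0; have [h1 h2] := hC _ u0.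
have r1 : Num.sqrt (- lambda1 delta beta mu lam (freq k)) != 0.
  by rewrite lt0r_neq0// sqrtr_gt0 oppr_gt0 lambda1_lt0.
have r2 : Num.sqrt (- lambda2 delta beta mu (freq k)) != 0.
  by rewrite lt0r_neq0// sqrtr_gt0 oppr_gt0 lambda2_lt0.
rewrite /sin_multiplier /sqrt_multiplier /cos_multiplier /fun_multiplier.
rewrite invmx_axis// axis_mxM// (le_trans (csqnormD _ _))//.
have cos1 (x : R) : cos x ^+ 2 <= 1.
  by rewrite cos2sin2 gerBl sqr_ge0.
have hf := csqnorm_axis_le _ (f k) _ _ 1 u0 (cos1 _) (cos1 _).
have hg := csqnorm_axis_le _ (g k) _ _ _ u0 h1 h2.
rewrite (le_trans (lerD (ler_wpM2l _ (hf _ _)) (ler_wpM2l _ hg)))//.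
have := powR_ge0 (1 + sqnorm (freq k : 'cV[R]_n)) (- theta).
move: (_ `^ _) => w w0; have wg := mulr_ge0 w0 g0.
have := mulr_ge0 t2 f0; have := mulr_ge0 t2 wg.
have := mulr_ge0 C0 f0; have := mulr_ge0 C0 wg; lra.
Qed.

End PeridynamicRegularity.

Theorem theorem16 (R : realType) (n : nat) (delta beta mu lam : R)
  (n_ge1 : (1 <= n)%N)
  (delta_gt0 : 0 < delta)
  (beta_lt : beta < n%:R + 2)
  (mu_gt0 : 0 < mu)
  (lambda1_lt0 : forall nu : 'cV[R]_n,
     nu != 0 -> lambda1 delta beta mu lam nu < 0)
  (lambda2_lt0 : forall nu : 'cV[R]_n,
     nu != 0 -> lambda2 delta beta mu nu < 0)
  (s1 s2 : R) (f g : fourier_family R n)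
  (hf : sobolev s1 f) (hg : sobolev s2 g) (t : R) (t_ge0 : 0 <= t) :
  let theta := Num.max 0 ((beta - n%:R) / 2) in
  let s := Num.min s1 (s2 + theta) in
  sobolev s (peridynamic_solution delta beta mu lam f g t).
Proof.
move=> theta s; move: hf hg => [[Cf [Nf hf]] sf] [[Cg [Ng hg]] sg].
have [C C0 hU] := peridynamic_solution_bound n delta beta mu lam n_ge1
  delta_gt0 beta_lt mu_gt0 lambda1_lt0 lambda2_lt0 f g t t_ge0.
rewrite -/theta in hU; have th0 : 0 <= theta by rewrite le_max lexx.
have w1 (k : 'cV[int]_n) : 1 <= 1 + sqnorm (freq k) :> R.
  by rewrite lerDl sqnorm_ge0.
split.
  exists (C * (`|Cf| + `|Cg|)), (Nf + Ng)%N => k.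
  apply: (le_trans (hU k)); rewrite -mulrA ler_wpM2l// mulrDl.
  have w0 : 0 <= 1 + sqnorm (freq k) :> R by rewrite (le_trans _ (w1 k)).
  have grow (K : R) (N N' : nat) : (N <= N')%N ->
      K * (1 + sqnorm (freq k)) ^+ N <= `|K| * (1 + sqnorm (freq k)) ^+ N'.
    move=> NN'; rewrite (le_trans (ler_wpM2r (exprn_ge0 _ w0) (ler_norm _)))//.
    by rewrite ler_wpM2l// ler_weXn2l.
  apply: lerD; first by rewrite (le_trans (hf k))// grow// leq_addr.
  rewrite (@le_trans _ _ (csqnorm (g k)))//.
    rewrite ler_piMl ?csqnorm_ge0//.
    by rewrite -[leRHS](powRr0 (1 + sqnorm (freq k))) ler_powR// oppr_le0.
  by rewrite (le_trans (hg k))// grow// leq_addl.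
apply: (@esum_lty_le _ _ C _ _ _ C0 _ _ _ sf sg) => k.
- by rewrite mulr_ge0 ?powR_ge0 ?csqnorm_ge0.
- by rewrite mulr_ge0 ?powR_ge0 ?csqnorm_ge0.
rewrite (le_trans (ler_wpM2l (powR_ge0 _ _) (hU k)))// mulrCA ler_wpM2l//.
rewrite mulrDr; apply: lerD.
  by rewrite ler_wpM2r ?csqnorm_ge0// ler_powR// ge_min lexx.
rewrite mulrA -powRD; last by rewrite (gt_eqF (lt_le_trans ltr01 (w1 k))) implybT.
by rewrite ler_wpM2r ?csqnorm_ge0// ler_powR// lerBlDr ge_min lexx orbT.
Qed.
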